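(* Let $k\ge 1$ be an integer and $\lambda>0$ a real number. Let $\{(N(t),I(t)),\,t\ge 0\}$ be the selling/incentive process with parameters $k$ and $\lambda$ described in the context (so $N(t)=1+kI(t)$, $N(0)=1$, and the rate of gaining an incentive when $I(t)=n$ is $\lambda_n=(nk+1)\lambda$). Then the mean and the variance of $N(t)$ depend on $t$ (they are non-constant functions of $t$), the distribution of $N(t)$ depends on $t$, and the process $\{N(t),t\ge0\}$ is not stationary.
   Context: Process: $\{I(t),t\ge 0\}$ is a continuous-time stochastic process with values in $\{0,1,2,\ldots\}$, nondecreasing in $t$, with $I(0)=0$ ($I(t)$ is the number of additional incentives obtained in $(0,t]$). For a fixed integer $k\ge1$, $N(t)=1+kI(t)$ (the minimum number of articles sold in order to have $I(t)+1$ incentives), so $N(t)$ takes values in $\{1,1+k,1+2k,\ldots\}$ and $N(0)=1$. For all $t\ge 0$ and $n\ge 0$ (with $P(I(t)=n)>0$), as $\Delta t\downarrow 0$, $$P\big(I(t+\Delta t)-I(t)=r\mid I(t)=n\big)=\begin{cases}1-\lambda_n\Delta t+o(\Delta t), & r=0,\\ \lambda_n\Delta t+o(\Delta t), & r=1,\\ o(\Delta t), & r\ge 2,\end{cases}$$ where $\lambda_n=(nk+1)\lambda$, $\lambda>0$, and the $o(\Delta t)$ terms do not depend on $t$. A process is stationary if its finite-dimensional distributions are invariant under time shifts. *)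

(* Defs.v *)
From HB Require Import structures.
From mathcomp Require Import all_boot all_order all_algebra.
From mathcomp Require Import all_classical all_reals all_analysis.

Set Implicit Arguments.
Unset Strict Implicit.
Unset Printing Implicit Defensive.

Import Order.TTheory GRing.Theory Num.Theory.
Import numFieldNormedType.Exports.

Local Open Scope classical_set_scope.
Local Open Scope ring_scope.

(* Processes indexed by [0, +oo[ are functions of t : R; every condition on
   them is restricted to 0 <= t, so values at negative times are irrelevant. *)

Definition cond_prob d (T : measurableType d) (R : realType)
    (P : probability T R) (A B : set T) : R :=
  fine (P (A `&` B)) / fine (P B).

Definition incentive_rate (R : realType) (k : nat) (lambda : R) (n : nat) : R :=
  (n * k + 1)%:R * lambda.

(* The terms of P(I(t+h) - I(t) = r | I(t) = n) that are not o(h). *)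
Definition incentive_transition (R : realType) (k : nat) (lambda : R)
    (n r : nat) (h : R) : R :=
  match r with
  | 0%N => 1 - incentive_rate k lambda n * h
  | 1%N => incentive_rate k lambda n * h
  | _ => 0
  end.

(* In [incentive_jumps] the remainder err and the range of h where the
   expansion holds may depend on n and r, but not on t.  The event
   I(t+h) - I(t) = r is written additively to avoid truncated subtraction. *)
Record incentive_process d (T : measurableType d) (R : realType)
    (P : probability T R) (k : nat) (lambda : R) (I : R -> T -> nat) : Prop := {
  incentive_measurable : forall t, 0 <= t -> measurable_fun [set: T] (I t);
  incentive_start : forall w, I 0 w = 0%N;
  incentive_nondecreasing : forall w s t,
    0 <= s -> s <= t -> (I s w <= I t w)%N;
  incentive_jumps : forall n r : nat, exists err : R -> R,
    (fun h => err h / h) @ 0^'+ --> (0 : R) /\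
    \forall h \near 0^'+, forall t : R, 0 <= t ->
      (0 < P [set w | I t w = n])%E ->
      cond_prob P [set w | I (t + h) w = (I t w + r)%N] [set w | I t w = n] =
        incentive_transition k lambda n r h + err h
}.

(* N(t), viewed as a real random variable. *)
Definition selling_process (T : Type) (R : realType) (k : nat)
    (I : R -> T -> nat) : R -> T -> R :=
  fun t w => (1 + k * I t w)%:R.

Definition same_law d d' (T : measurableType d) (T' : measurableType d')
    (R : realType) (P : probability T R) (X Y : T -> T') : Prop :=
  forall A : set T', measurable A -> pushforward P X A = pushforward P Y A.

(* n.-tuple R carries the product sigma-algebra. *)
Definition stationary d (T : measurableType d) (R : realType)
    (P : probability T R) (X : R -> T -> R) : Prop :=
  forall (n : nat) (ts : n.-tuple R) (h : R),
    (forall i, 0 <= tnth ts i) -> 0 <= h ->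
    same_law P (fun w => [tuple X (tnth ts i) w | i < n])
               (fun w => [tuple X (tnth ts i + h) w | i < n]).

(* A nonconstant function on [0, +oo[ with finite values. *)
Definition finite_nonconstant (R : realType) (f : R -> \bar R) : Prop :=
  (forall t, 0 <= t -> f t \is a fin_num) /\
  exists s t, [/\ 0 <= s, 0 <= t & f s <> f t].

(* Main.v *)
Require Import Defs.
From HB Require Import structures.
From mathcomp Require Import all_boot all_order all_algebra.
From mathcomp Require Import all_classical all_reals all_analysis.
From mathcomp Require Import measurable_realfun ring lra.

Import Order.TTheory GRing.Theory Num.Theory.
Import numFieldNormedType.Exports.

Local Open Scope classical_set_scope.
Local Open Scope ring_scope.

(** Nonconstancy is elementary: [N 0] is the constant 1, while the jump
    expansion at [t = 0], [n = r = 0] gives [0 < P (I h = 0) < 1] for small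
    [h > 0] ([exists_partial_level]).  Then [N h] exceeds 1 by at least 1 on an
    event of positive probability, so its mean is larger than 1; and [N h] takes
    the value 1, different from its mean, with positive probability, so by
    Chebyshev's inequality its variance is positive.  The laws of [N 0] and
    [N h] differ on the singleton 1, and a stationary process would have equal
    one-dimensional laws at times 0 and [h].

    The substance is that mean and variance are finite.  The process is a Yule
    process, with rates linear in the state, and the weight
    [g m = (m + 1) (m + 2)] satisfies
      [rate m * (g (m + 1) - g m) <= C * g m],  [C = 2 k lambda]
    ([moment_weight_drift]).  The moment truncated to the states below [M],
      [f_M t = sum_(m < M) g m * P (I t = m)],
    involves finitely many jump expansions, whose errors are uniform in [t], so
      [f_M (t + h) <= (1 + C h) f_M t + h]  for all small [h > 0] and all [t]
    ([truncated_moment_step]).  Iterating [K] times with [h = t / K] and [K]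
    large gives [f_M t <= exp (C t) (2 + t)] ([truncated_moment_le]).  How large
    [K] must be depends on [M], but the bound does not, so letting [M] grow
    bounds the expectation of [g (I t)], which dominates [N t ^ 2] up to the
    factor [k ^ 2]. *)

Section incentive_process_moments.
Context {d : measure_display} {T : measurableType d} {R : realType}
  {P : probability T R} {k : nat} {lambda : R} {I : R -> T -> nat}.
Context (hI : incentive_process P k lambda I).

Local Notation level t n := [set w | I t w = n].
Local Notation pr A := (fine (P A)).

(** * State probabilities and their one-step transitions *)

Lemma measurable_level t n : 0 <= t -> measurable (level t n).
Proof.
move=> t0; have := incentive_measurable hI t0 measurableT (Y := [set n]).
by rewrite setTI; apply.
Qed.

Lemma level_prob_fin t n : 0 <= t -> P (level t n) \is a fin_num.
Proof. by move=> t0; apply: fin_num_measure; exact: measurable_level. Qed.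

Lemma level_prob_ge0 t n : 0 <= pr (level t n).
Proof. exact: fine_ge0. Qed.

Lemma level_prob_le1 t n : 0 <= t -> pr (level t n) <= 1.
Proof.
move=> t0; rewrite -lee_fin fineK ?level_prob_fin//.
by apply: probability_le1; exact: measurable_level.
Qed.

Lemma level0 : level 0 0%N = [set: T].
Proof. by apply/seteqP; split => w //= _; exact: incentive_start hI w. Qed.

(** Multiplying the conditional expansion by [P (I t = n)] removes the
    positivity condition: if this probability vanishes, so does the joint one.
    The range of [h] is chosen before [t], which is what allows an iteration in
    time steps of fixed length. *)
Lemma joint_jump_prob n r (eps : R) : 0 < eps ->
  \forall h \near 0^'+, forall t, 0 <= t ->
    `|pr (level (t + h) (n + r)%N `&` level t n)
      - incentive_transition k lambda n r h * pr (level t n)| <= eps * h.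
Proof.
move=> eps0; have [err [err0 jump]] := incentive_jumps hI n r.
move/cvgr0Pnorm_le : err0 => /(_ _ eps0) err0.
move: (nbhs_right_gt (0 : R)) err0 jump.
apply: filterS3 => h h0 errh jump t t0.
have th0 : 0 <= t + h by rewrite addr_ge0// ltW.
have {}errh : `|err h| <= eps * h.
  by move: errh; rewrite normrM normfV (gtr0_norm h0) ler_pdivrMr.
have := level_prob_ge0 t n; rewrite le_eqVlt => /predU1P[p0|p0].
  suff -> : P (level (t + h) (n + r)%N `&` level t n) = 0%E.
    by rewrite /= -p0 mulr0 subr0 normr0 mulr_ge0 ?ltW.
  apply/eqP; rewrite eq_le measure_ge0 andbT.
  have -> : 0%E = P (level t n) by rewrite -(fineK (level_prob_fin _ n t0)) -p0.
  apply: le_measure; rewrite ?inE//; first apply: measurableI;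
    exact: measurable_level.
have Pp0 : (0 < P (level t n))%E.
  by rewrite -(fineK (level_prob_fin _ n t0)) lte_fin.
have -> : level (t + h) (n + r)%N `&` level t n =
    [set w | I (t + h) w = (I t w + r)%N] `&` level t n.
  by apply/seteqP; split => w /= [Ith It]; rewrite Ith It.
move: (jump t t0 Pp0).
rewrite /cond_prob => /(canRL (divfK (lt0r_neq0 p0))) ->.
rewrite mulrDl addrAC subrr add0r normrM (gtr0_norm p0).
by apply: le_trans errh; rewrite ler_piMr// level_prob_le1.
Qed.

(** Main part of the conditional probability to be in [n] at time [t + h], given
    state [m] at time [t]. *)
Definition one_step (m n : nat) (h : R) : R :=
  (n == m)%:R * (1 - incentive_rate k lambda m * h)
  + (n == m.+1)%:R * (incentive_rate k lambda m * h).

(** When [n < m] the joint event is empty, as [I] is nondecreasing. *)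
Lemma joint_level_prob_le m n (eps : R) : 0 < eps ->
  \forall h \near 0^'+, forall t, 0 <= t ->
    pr (level (t + h) n `&` level t m)
      <= one_step m n h * pr (level t m) + eps * h.
Proof.
move=> eps0; have [mn|nm] := leqP m n; last first.
  near=> h => t t0.
  have h0 : 0 < h by near: h; exact: nbhs_right_gt.
  suff -> : level (t + h) n `&` level t m = set0.
    rewrite measure0 /one_step ltn_eqF// ltn_eqF ?ltnS 1?ltnW//.
    by rewrite !mul0r add0r mul0r add0r mulr_ge0 ?ltW.
  apply/seteqP; split => w //= [In Im].
  have tth : t <= t + h by rewrite lerDl ltW.
  by have := incentive_nondecreasing hI w t0 tth; rewrite In Im leqNgt nm.
have := joint_jump_prob m (n - m) eps eps0; apply: filterS => h + t t0.
move=> /(_ t t0); rewrite subnKC// => /ler_normlP[_].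
rewrite lerBlDl => /le_trans; apply; rewrite lerD2r.
rewrite (_ : incentive_transition _ _ _ _ _ = one_step m n h)//.
rewrite /one_step -{2 3}(subnKC mn); case: (n - m)%N => [|[|r]] /=.
- by rewrite addn0 eqxx ltn_eqF// mul1r mul0r addr0.
- by rewrite addn1 eqxx gtn_eqF// mul1r mul0r add0r.
- by rewrite !gtn_eqF ?mul0r ?addr0 ?addnS ?ltnS ?leq_addr ?leqW ?leq_addr.
Unshelve. all: by end_near. Qed.

(** * A Lyapunov bound on the second moment *)

(** This rising factorial replaces the square because its increment
    [2 (m + 2)] has [m + 2] as a factor: times a rate at most
    [k lambda (m + 1)], it is a multiple of the weight itself. *)
Definition moment_weight (m : nat) : R := (m.+1 * m.+2)%:R.

Definition growth_rate : R := 2 * k%:R * lambda.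

Definition truncated_moment (M : nat) (t : R) : R :=
  \sum_(m < M) moment_weight m * pr (level t m).

Lemma moment_weight_ge0 m : 0 <= moment_weight m.
Proof. exact: ler0n. Qed.

Context (hk : (1 <= k)%N) (hlambda : 0 < lambda).

Lemma growth_rate_ge0 : 0 <= growth_rate.
Proof. by rewrite !mulr_ge0// ltW. Qed.

Lemma incentive_rate_ge0 m : 0 <= incentive_rate k lambda m.
Proof. by rewrite mulr_ge0// ltW. Qed.

(** The inequality uses [m k + 1 <= k (m + 1)], where [k >= 1] enters. *)
Lemma moment_weight_drift m (h : R) : 0 <= h ->
  moment_weight m * (1 - incentive_rate k lambda m * h)
    + moment_weight m.+1 * (incentive_rate k lambda m * h)
  <= (1 + growth_rate * h) * moment_weight m.
Proof.
move=> h0.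
have -> : moment_weight m * (1 - incentive_rate k lambda m * h)
    + moment_weight m.+1 * (incentive_rate k lambda m * h)
  = moment_weight m
    + (moment_weight m.+1 - moment_weight m) * (incentive_rate k lambda m * h).
  by ring.
have -> : moment_weight m.+1 - moment_weight m = 2 * m.+2%:R.
  by rewrite /moment_weight !natrM -!natr1; ring.
rewrite [leRHS]mulrDl mul1r lerD2l.
have rate : incentive_rate k lambda m <= k%:R * lambda * m.+1%:R.
  rewrite /incentive_rate mulrAC; apply: ler_wpM2r; first exact: ltW.
  rewrite -natrM ler_nat.
  by rewrite mulnS mulnC addnC leq_add2r.
rewrite mulrA.
have -> : growth_rate * h * moment_weight m
    = 2 * m.+2%:R * (k%:R * lambda * m.+1%:R) * h.
  by rewrite /growth_rate /moment_weight natrM; ring.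
by rewrite ler_wpM2r// ler_wpM2l// mulr_ge0.
Qed.

(** Truncation can only lose the nonnegative term of the jump from [M - 1]
    to [M]. *)
Lemma one_step_moment_le m M (h : R) : (m < M)%N -> 0 <= h ->
  \sum_(n < M) moment_weight n * one_step m n h
    <= (1 + growth_rate * h) * moment_weight m.
Proof.
move=> mM h0.
have pick j (c : R) : \sum_(n < M) moment_weight n * ((n == j :> nat)%:R * c)
    = if (j < M)%N then moment_weight j * c else 0.
  rewrite -(big_ord1_eq +%R (fun n => moment_weight n * c)) [RHS]big_mkcond/=.
  by apply: eq_bigr => n _; case: eqP => _; rewrite ?mul1r// mul0r mulr0.
rewrite /one_step; under eq_bigr do rewrite mulrDr.
rewrite big_split/= !pick mM.
apply: le_trans (moment_weight_drift m h h0); rewrite lerD2l.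
have drift_ge0 : 0 <= moment_weight m.+1 * (incentive_rate k lambda m * h).
  by apply: mulr_ge0 => //; apply: mulr_ge0 => //; exact: incentive_rate_ge0.
by case: ifP.
Qed.

(** Monotonicity of [I] makes the sum finite: if [I (t + h) = n < M] then
    [I t < M]. *)
Lemma level_prob_le_sum M n t h : 0 <= t -> 0 <= h -> (n < M)%N ->
  pr (level (t + h) n) <= \sum_(m < M) pr (level (t + h) n `&` level t m).
Proof.
move=> t0 h0 nM; have th0 := addr_ge0 t0 h0.
have mth := measurable_level (t + h) n th0.
have mj m : measurable (level (t + h) n `&` level t m).
  by apply: measurableI => //; exact: measurable_level.
have fj m : P (level (t + h) n `&` level t m) \is a fin_num.
  exact: fin_num_measure.
rewrite -lee_fin fineK ?level_prob_fin// -sumEFin.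
under eq_bigr do rewrite fineK//.
have := @content_subadditive _ _ _ P (level (t + h) n)
  (fun m : nat => level (t + h) n `&` level t m) M.
apply => //.
move=> w /= In.
rewrite -(bigcup_mkord M (fun m => level (t + h) n `&` level t m)).
exists (I t w) => //=.
apply: leq_ltn_trans nM; rewrite -In.
by apply: (incentive_nondecreasing hI) => //; rewrite lerDl.
Qed.

(** Conditioning on the state at time [t], the main parts contribute at most
    [1 + growth_rate * h] times the moment at time [t]. *)
Lemma truncated_moment_step M (eps : R) : 0 < eps ->
  \forall h \near 0^'+, forall t, 0 <= t ->
    truncated_moment M (t + h)
      <= (1 + growth_rate * h) * truncated_moment M t + eps * h.
Proof.
move=> eps0.
(* The M ^ 2 joint probabilities carry errors whose weighted total is S
   times the common error; dividing eps by 1 + S rather than S avoids the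
   case M = 0. *)
pose S := \sum_(m < M) \sum_(n < M) moment_weight n.
have S0 : 0 <= S.
  by apply: sumr_ge0 => m _; apply: sumr_ge0 => n _; exact: moment_weight_ge0.
have S1 : 0 < 1 + S by rewrite ltr_pwDl.
have eps'0 : 0 < eps / (1 + S) by rewrite divr_gt0.
have joint : \forall h \near 0^'+, forall mn : 'I_M * 'I_M,
    forall t, 0 <= t -> pr (level (t + h) mn.2 `&` level t mn.1)
      <= one_step mn.1 mn.2 h * pr (level t mn.1) + eps / (1 + S) * h.
  by apply: filter_forall => mn; exact: joint_level_prob_le.
move: (nbhs_right_gt (0 : R)) joint; apply: filterS2 => h h0 joint t t0.
apply: (@le_trans _ _ (\sum_(m < M) \sum_(n < M) moment_weight n *
    (one_step m n h * pr (level t m) + eps / (1 + S) * h))).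
  rewrite exchange_big/=; apply: ler_sum => n _; rewrite -mulr_sumr.
  rewrite ler_wpM2l ?moment_weight_ge0//.
  apply: le_trans (level_prob_le_sum _ _ _ _ t0 (ltW h0) (ltn_ord n)) _.
  apply: ler_sum => m _.
  exact: joint (m, n) t t0.
under eq_bigr do under eq_bigr do rewrite mulrDr mulrA.
under eq_bigr do rewrite big_split/= -!mulr_suml.
rewrite big_split/= -mulr_suml -/S; apply: lerD; last first.
  rewrite mulrA ler_wpM2r ?(ltW h0)// mulrCA ler_piMr ?(ltW eps0)//.
  by rewrite ler_pdivrMr// mul1r lerDr.
rewrite mulr_sumr; apply: ler_sum => m _.
by rewrite mulrA ler_wpM2r ?level_prob_ge0// one_step_moment_le// ltW.
Qed.

Lemma truncated_moment0 M : truncated_moment M 0 <= 2.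
Proof.
case: M => [|M]; first by rewrite /truncated_moment big_ord0.
rewrite /truncated_moment big_ord_recl level0 probability_setT/= mulr1.
rewrite big1 ?addr0// => m _.
rewrite (_ : level 0 _ = set0) ?measure0/= ?mulr0//.
by apply/seteqP; split => w //=; rewrite (incentive_start hI w).
Qed.

(** A discrete Gronwall argument with [K] equal steps.  The term [2] bounds the
    moment at time 0, where [I = 0], and [t] is the accumulated error. *)
Lemma truncated_moment_le M t : 0 <= t ->
  truncated_moment M t <= expR (growth_rate * t) * (2 + t).
Proof.
rewrite le_eqVlt => /predU1P[<-|t0].
  by rewrite mulr0 expR0 mul1r addr0 truncated_moment0.
have := truncated_moment_step M 1 ltr01.
rewrite near_withinE => /nbhs_ballP[delta /= delta0 step].
pose K := (Num.trunc (t / delta)).+1.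
pose h := t / K%:R.
have K0 : 0 < K%:R :> R by rewrite ltr0n.
have h0 : 0 < h by rewrite divr_gt0.
have hdelta : h < delta.
  rewrite /h ltr_pdivrMr// mulrC -ltr_pdivrMr//.
  by rewrite /K truncnS_gt.
have {}step s : 0 <= s -> truncated_moment M (s + h)
    <= (1 + growth_rate * h) * truncated_moment M s + h.
  move=> s0; have := step h _ h0 s s0; rewrite mul1r; apply.
  by rewrite /ball/= sub0r normrN gtr0_norm.
have C1 : 1 <= 1 + growth_rate * h.
  by rewrite lerDl mulr_ge0 ?growth_rate_ge0 ?ltW.
have iter j : truncated_moment M (j%:R * h)
    <= (1 + growth_rate * h) ^+ j * (2 + j%:R * h).
  elim: j => [|j ih]; first by rewrite mul0r expr0 mul1r addr0 truncated_moment0.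
  rewrite -natr1 mulrDl mul1r; apply: le_trans (step _ _) _.
    by rewrite mulr_ge0 ?(ltW h0).
  rewrite addrA mulrDr lerD//.
    by rewrite exprS -mulrA ler_wpM2l// (le_trans ler01).
  by rewrite ler_peMl ?(ltW h0)// exprn_ege1.
have := iter K; rewrite (_ : K%:R * h = t); last first.
  by rewrite /h mulrC divfK// lt0r_neq0.
move=> /le_trans; apply; rewrite ler_wpM2r//; first by rewrite addr_ge0// ltW.
have -> : growth_rate * t = growth_rate * h * K%:R.
  by rewrite /h -mulrA divfK// lt0r_neq0.
rewrite expRM_natr lerXn2r ?nnegrE ?expR_ge0 ?(le_trans ler01)//.
exact: expR_ge1Dx.
Qed.

(** The integral is the series of the [moment_weight n * P (I t = n)], whose
    partial sums are the truncated moments. *)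
Lemma integral_moment_weight_lty t : 0 <= t ->
  (\int[P]_w (moment_weight (I t w))%:E < +oo)%E.
Proof.
move=> t0.
pose f n w := ((moment_weight n)%:E * (\1_(level t n) w)%:E)%E.
have fE w : ((moment_weight (I t w))%:E = \sum_(n <oo) f n w)%E.
  rewrite (@nneseries_split _ _ 0 (I t w).+1)//; last first.
    by move=> n _; rewrite mule_ge0 ?lee_fin ?moment_weight_ge0.
  rewrite add0n eseries0 ?adde0; last first.
    move=> n In _; rewrite /f indicE memNset ?mule0//= => E.
    by move: In; rewrite E ltnn.
  rewrite big_mkord big_ord_recr/= big1 ?add0e.
    by rewrite /f indicE mem_set// mule1.
  move=> n _; rewrite /f indicE memNset ?mule0//= => E.
  by have := ltn_ord n; rewrite -E ltnn.
under eq_integral do rewrite fE.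
rewrite integral_nneseries//; last 2 first.
- move=> n; apply: emeasurable_funM; first exact: measurable_cst.
  by apply/measurable_EFinP; apply: measurable_indic; exact: measurable_level.
- by move=> n w _; rewrite mule_ge0 ?lee_fin ?moment_weight_ge0.
apply: (@le_lt_trans _ _ (expR (growth_rate * t) * (2 + t))%:E); last exact: ltry.
have f_int n : (\int[P]_w f n w = (moment_weight n * pr (level t n))%:E)%E.
  rewrite ge0_integralZl_EFin ?moment_weight_ge0//; last first.
    by apply/measurable_EFinP; apply: measurable_indic; exact: measurable_level.
  rewrite integral_indic//; last exact: measurable_level.
  by rewrite setIT EFinM fineK ?level_prob_fin.
apply: lime_le.
  by apply: is_cvg_ereal_nneg_natsum => n _; rewrite f_int lee_fin mulr_ge0
    ?moment_weight_ge0 ?level_prob_ge0.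
near=> M; rewrite big_mkord.
under eq_bigr do rewrite f_int.
by rewrite sumEFin lee_fin; exact: truncated_moment_le.
Unshelve. all: by end_near. Qed.

Local Notation N := (selling_process k I).

(** * Mean and variance of the selling process *)

Lemma measurable_selling t : 0 <= t -> measurable_fun [set: T] (N t : T -> R).
Proof.
move=> t0; apply: (measurableT_comp (f := fun n => (1 + k * n)%:R : R)) => //.
exact: (incentive_measurable hI).
Qed.

Lemma selling_ge1 t w : 1 <= N t w :> R.
Proof. by rewrite ler1n. Qed.

(** Domination: [1 + k m <= k (m + 1)], hence
    [(1 + k m) ^ 2 <= k ^ 2 (m + 1) (m + 2)]. *)
Lemma selling_sqr_Lfun1 t : 0 <= t -> (N t * N t : T -> R) \in Lfun P 1.
Proof.
move=> t0; apply/Lfun1_integrable.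
have mN := measurable_selling t t0.
apply/integrableP; split.
  by apply/measurable_EFinP; exact: measurable_funM.
apply: (@le_lt_trans _ _
    (\int[P]_w ((k ^ 2)%:R%:E * (moment_weight (I t w))%:E))%E).
  apply: ge0_le_integral => //.
  - apply: measurableT_comp => //; apply/measurable_EFinP.
    exact: measurable_funM.
  - apply/measurable_EFinP.
    apply: (measurableT_comp
      (f := fun n => (k ^ 2)%:R * moment_weight n : R)) => //.
    exact: (incentive_measurable hI).
  move=> w _; rewrite -EFinM lee_fin ger0_norm; last by rewrite mulr_ge0.
  rewrite fctE /selling_process /moment_weight -!natrM ler_nat.
  rewrite -mulnn mulnACA.
  have Nk : (1 + k * I t w <= k * (I t w).+1)%N by rewrite mulnS leq_add2r.
  by rewrite leq_mul// (leq_trans Nk)// leq_mul.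
rewrite ge0_integralZl_EFin//.
- by rewrite lte_mul_pinfty ?lee_fin ?integral_moment_weight_lty.
- by move=> w _; rewrite lee_fin moment_weight_ge0.
- apply/measurable_EFinP.
  apply: (measurableT_comp (f := moment_weight)) => //.
  exact: (incentive_measurable hI).
Qed.

Lemma selling_Lfun1 t : 0 <= t -> (N t : T -> R) \in Lfun P 1.
Proof.
move=> t0; apply/Lfun1_integrable.
have /Lfun1_integrable := selling_sqr_Lfun1 t t0.
apply: le_integrable => //.
  by apply/measurable_EFinP; exact: measurable_selling.
move=> w _ /=; rewrite lee_fin normrM ler_peMl//.
by rewrite ger0_norm ?selling_ge1// (le_trans ler01)// selling_ge1.
Qed.

(** With an error of at most [lambda h / 2], the probability to stay at 0 up to
    time [h] lies between [1 - 3 lambda h / 2] and [1 - lambda h / 2]. *)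
Lemma exists_partial_level : exists2 h : R, 0 < h &
  (0 < P (level h 0%N) < 1)%E.
Proof.
have l2 : 0 < lambda / 2 by rewrite divr_gt0.
have : \forall h \near 0^'+, [/\ 0 < h, h * lambda < 2^-1 &
    `|pr (level h 0%N) - (1 - lambda * h)| <= lambda / 2 * h].
  near=> h; split; first by near: h; exact: nbhs_right_gt.
    rewrite -ltr_pdivlMr//; near: h; apply: nbhs_right_lt.
    by rewrite divr_gt0.
  near: h; have := joint_jump_prob 0 0 (lambda / 2) l2.
  apply: filterS => h /(_ 0 (lexx _)).
  rewrite level0 setIT add0r probability_setT/= mulr1.
  by rewrite /incentive_rate mul0n add0n mul1r.
move=> /filter_ex[h [h0 hl]]; rewrite ler_norml => /andP[lo hi].
exists h => //; rewrite -(fineK (level_prob_fin _ _ (ltW h0))) !lte_fin.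
by apply/andP; split; nra.
Unshelve. all: by end_near. Qed.

Lemma selling0 : N 0 = cst 1 :> (T -> R).
Proof.
by apply/funext => w; rewrite /selling_process (incentive_start hI) muln0.
Qed.

Lemma selling_eq1 t : [set w | N t w = 1 :> R] = level t 0%N.
Proof.
apply/seteqP; split => w /= => [/eqP|It]; last first.
  by rewrite /selling_process It muln0.
rewrite /selling_process -[1]/(1%:R) eqr_nat -[X in _ == X]addn0 eqn_add2l.
by rewrite muln_eq0 => /orP[/eqP k0|/eqP//]; move: hk; rewrite k0.
Qed.

(** [N t - 1] is at least the indicator of the event [I t <> 0]. *)
Lemma expectation_selling_gt1 t : 0 <= t -> (P (level t 0%N) < 1)%E ->
  (1 < 'E_P[N t])%E.
Proof.
move=> t0 p1; have mlev := measurable_level t 0 t0.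
have pC : (0 < P (~` level t 0%N))%E.
  by rewrite probability_setC// sube_gt0.
have -> : ('E_P[N t] = 1 + 'E_P[(N t \- cst 1)%R])%E.
  rewrite expectationB ?selling_Lfun1 ?Lfun_cst// expectation_cst.
  by rewrite [RHS]addeC subeK.
rewrite lteDl//; apply: lt_le_trans pC _.
rewrite -expectation_indic; last exact: measurableC.
apply: expectation_le.
- by apply: measurable_indic; exact: measurableC.
- by apply: measurable_funB => //; exact: measurable_selling.
- by move=> w.
- by move=> w; rewrite subr_ge0 selling_ge1.
apply: aeW => w /=; rewrite indicE; case: (boolP (w \in _)) => [|_].
  rewrite inE => /= /eqP; rewrite -lt0n => Iw.
  rewrite lerBrDr /selling_process -[leLHS](natrD _ 1 1) ler_nat leq_add2l.
  by rewrite muln_gt0 hk.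
by rewrite subr_ge0 selling_ge1.
Qed.

(** A zero variance would force, by Chebyshev's inequality, the value 1 of
    [N t] on [I t = 0] to have probability zero, since the mean exceeds 1. *)
Lemma variance_selling_gt0 t : 0 <= t -> (0 < P (level t 0%N) < 1)%E ->
  (0 < 'V_P[N t])%E.
Proof.
move=> t0 /andP[p0 p1]; rewrite lt0e variance_ge0 andbT.
apply/eqP => V0.
have mean_gt1 := expectation_selling_gt1 t t0 p1.
have meanE := fineK (expectation_fin_num (selling_Lfun1 t t0)).
rewrite -meanE lte_fin in mean_gt1.
pose X : {RV P >-> R} := HB.pack (N t : T -> R)
  (isMeasurableFun.Build _ _ _ _ (N t : T -> R) (measurable_selling t t0)).
have eps0 : 0 < fine 'E_P[N t]%E - 1 by rewrite subr_gt0.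
have := chebyshev X eps0; rewrite [X in (_ * X)%E]V0 mule0.
apply/negP; rewrite -ltNge; apply: lt_le_trans p0 _.
rewrite -selling_eq1; apply: le_measure; rewrite ?inE.
- by rewrite selling_eq1; exact: measurable_level.
- rewrite -[X in measurable X]setTI.
  apply: (@measurable_fun_ler _ _ _ _ (cst _)) => //.
  by apply: measurableT_comp => //; exact: measurable_funB.
- by move=> w /= ->; rewrite distrC ler_norm.
Qed.

End incentive_process_moments.

Theorem mainTheorem3 (d : measure_display) (T : measurableType d)
    (R : realType) (P : probability T R) (k : nat) (lambda : R)
    (I : R -> T -> nat) (hk : (1 <= k)%N) (hlambda : 0 < lambda)
    (hI : incentive_process P k lambda I) :
  let N := selling_process k I in
  [/\ finite_nonconstant (fun t => 'E_P[N t]%E),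
      finite_nonconstant (fun t => 'V_P[N t]%E),
      (exists s t : R, [/\ 0 <= s, 0 <= t & ~ same_law P (N s) (N t)]) &
      ~ stationary P N].
Proof.
move=> N.
have [h h0 /andP[p0 p1]] := exists_partial_level hI hlambda.
have h0' := ltW h0.
(* The laws differ on the singleton 1, that is, on the event I = 0. *)
have lawN : ~ same_law P (N 0) (N h).
  move=> /(_ [set 1] (measurable_set1 1)) law.
  have {law} : P [set w | N 0 w = 1] = P [set w | N h w = 1] := law.
  rewrite !(selling_eq1 hk) (level0 hI) probability_setT => E.
  by rewrite -E ltxx in p1.
split.
- split; first by move=> t t0; apply/expectation_fin_num/(selling_Lfun1 hI).
  exists 0, h; split=> //; rewrite /N (selling0 hI) expectation_cst => E.
  by have := expectation_selling_gt1 hI hk hlambda h h0' p1; rewrite -E ltxx.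
- split.
    move=> t t0; apply: covariance_fin_num.
    + exact: (selling_Lfun1 hI).
    + exact: (selling_Lfun1 hI).
    + exact: (selling_sqr_Lfun1 hI).
  exists 0, h; split=> //; rewrite /N (selling0 hI) variance_cst => E.
  have := variance_selling_gt0 hI hk hlambda h h0'.
  by rewrite p0 p1 -E ltxx => /(_ isT).
- by exists 0, h.
- move=> stat; apply: lawN => A mA.
  (* A Borel set A is tested through its cylinder in the 1-tuples. *)
  pose B : set (1.-tuple R) := (fun v => tnth v ord0) @^-1` A.
  have mB : measurable B by rewrite -[B]setTI; exact: measurable_tnth.
  have shift s : N s @^-1` A = (fun w => [tuple N s w | i < 1]) @^-1` B.
    by apply/seteqP; split => w; rewrite /B/= tnth_mktuple.
  have ts0 i : 0 <= tnth [tuple (0 : R)] i by rewrite (tnth_nth 0) ord1.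
  have := stat 1%N [tuple 0] h ts0 h0' B mB.
  have tupleE (f : R -> R) w : [tuple N (f (tnth [tuple 0] i)) w | i < 1]
      = [tuple N (f 0) w | i < 1].
    by apply: eq_mktuple => i; rewrite (tnth_nth 0) ord1.
  rewrite /pushforward !shift.
  rewrite (_ : (fun w => [tuple N (tnth [tuple 0] i) w | i < 1])
    = (fun w => [tuple N 0 w | i < 1])); last first.
    by apply/funext => w; exact: (tupleE id).
  rewrite (_ : (fun w => [tuple N (tnth [tuple 0] i + h) w | i < 1])
    = (fun w => [tuple N h w | i < 1]))//.
  by apply/funext => w; rewrite (tupleE (fun s => s + h)) add0r.
Qed.
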